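(* Let $\mathbf{k}$ be a field, $X=\{x_i\mid i\in I\}$ a well-ordered set, let $[X^+]_\omega$ carry the deg-lex-center ordering, and let $T'$ be the subset of $Di\langle X\rangle$ consisting of the polynomials $$[w]_l\dashv[v]_n\dashv[u]_m-[w]_l\dashv[u]_m\dashv[v]_n,\qquad [w]_l\vdash[v]_n\vdash[u]_m-[w]_l\vdash[u]_m\vdash[v]_n,$$ where $[u]_m,[v]_n,[w]_l\in[X^+]_\omega$. Then: (i) $Di\langle X\mid T'\rangle=Di\langle X\mid S'\rangle$ (i.e. $Id(T')=Id(S')$), where $S'$ consists of the nonzero polynomials among $$[vxu]_{|v|+1}-[vx\lfloor u\rfloor]_{|v|+1}\quad(u,v\in X^*,\ x\in X,\ |u|\ge2,\ |v|\le1),$$ $$[yvxu]_{|v|+2}-[y\lfloor vxu\rfloor]_3\quad(u,v\in X^*,\ x,y\in X,\ |v|\ge1).$$ (ii) $S'$ is a Gröbner-Shirshov basis in $Di\langle X\rangle$. (iii) The set $$\{[ux_{i_1}\cdots x_{i_n}]_{|u|+1}\mid x_{i_2}\le\cdots\le x_{i_n},\ x_{i_l}\in X,\ 1\le l\le n,\ n\in\mathbb{Z}^+,\ u\in X^*,\ |u|\le1\}$$ $$\cup\ \{[x_{j_1}\cdots x_{j_m}]_3\mid x_{j_2}\le\cdots\le x_{j_m},\ x_{j_k}\in X,\ 1\le k\le m,\ m\in\mathbb{Z}^+,\ m\ge3\}$$ is a $\mathbf{k}$-basis of the dialgebra $Di\langle X\mid T'\rangle$ and is a set of normal forms of elements of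 the free right commutative disemigroup $Disgp\langle X\mid T'\rangle$ (i.e. every element of that disemigroup is the class of exactly one element of the set).
   Context: Free dialgebra and disemigroup. A dialgebra over $\mathbf{k}$ (resp. a disemigroup) is a $\mathbf{k}$-module with two $\mathbf{k}$-bilinear associative products (resp. a set with two associative operations) $\vdash,\dashv$ satisfying $a\dashv(b\vdash c)=a\dashv(b\dashv c)$, $(a\dashv b)\vdash c=(a\vdash b)\vdash c$, $a\vdash(b\dashv c)=(a\vdash b)\dashv c$. A disemigroup is right commutative if $a\vdash b\vdash c=a\vdash c\vdash b$ and $a\dashv b\dashv c=a\dashv c\dashv b$ for all $a,b,c$. $X^+$ is the set of nonempty words on $X$, $X^*$ the set of all words including the empty one, $|u|$ the length of $u$. $[X^+]_\omega=\{[u]_m\mid u\in X^+,\ 1\le m\le |u|\}$ is the set of normal diwords (formal pairs $(u,m)$); $u$ is the associative word and $p([u]_m)=m$ the position of center. With $[u]_m\vdash[v]_n=[uv]_{|u|+n}$, $[u]_m\dashv[v]_n=[uv]_m$ it is the free disemigroup on $X$, and the $\mathbf{k}$-space $Di\langle X\rangle$ with basis $[X^+]_\omega$ and these products extended bilinearly is the free dialgebra ($x\in X$ is identified with $[x]_1$). An ideal is a subspace closed under both products, on both sides, with arbitrary elements; $Id(S)$ is the ideal generated by $S$, $Di\langle X\mid S\rangle=Di\langle X\rangle/Id(S)$. $Disgp\langle X\mid T'\rangle$ is the quotient of the disemigroup $[X^+]_\omega$ by the congruence generated by the pairs of diwords whose differences form $T'$; it is the free right commutative disemigroup generated by $X$.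 For $u\in X^*$, $\lfloor u\rfloor$ is the word obtained by rearranging the letters of $u$ in non-decreasing order. A subset of $[X^+]_\omega$ is said to be a basis of a quotient if the images of its elements are distinct and form a basis. Orderings. The deg-lex ordering on $X^+$ compares words first by length and then lexicographically from the left. The deg-lex-center ordering on $[X^+]_\omega$: $[u]_m>[v]_n$ iff $(u,m)>(v,n)$ lexicographically (words compared by deg-lex). For $0\ne f\in Di\langle X\rangle$: $\overline f$ is the leading (largest) normal diword of $f$, $lc(f)$ its coefficient, $lt(f)=lc(f)\overline f$, $\widetilde f$ the associative word of $\overline f$, $r_f=f-lt(f)$. By convention $0$ is smaller than every diword and every word, and $\overline 0=\widetilde 0=0$. $f\neq0$ is monic if $lc(f)=1$; a set is monic if all its elements are. $f\ne0$ is strong if $\widetilde f>\widetilde{r_f}$ (in particular if $r_f=0$). Normal $S$-diwords ($S$ monic). For $s\in S$, $a,b\in X^*$ put $P([asb])=\{n: 1\le n\le|a|\}\cup\{|a|+p(\overline s)\}\cup\{n:|a\widetilde s|<n\le|a\widetilde sb|\}$ if $s$ is strong, and $P([asb])=\{|a|+p(\overline s)\}$ if $s$ is not strong. For $l\in P([asb])$ the normal $S$-diword $[asb]_l$ is the element: $[a]_l\dashv s\dashv[b]_1$ if $l\le|a|$; $[a]_{|a|}\vdash s\dashv[b]_1$ if $l=|a|+p(\overline s)$; $[a]_{|a|}\vdash s\vdash[b]_{l-|a\widetilde s|}$ if $l>|a\widetilde s|$ (factors with empty word omitted). One has $\overline{[asb]_l}=[a\widetilde sb]_l$. Compositions of monic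 $f,g\in Di\langle X\rangle$ (same notation $[afb]_l$, $P$ used for single polynomials): 1) If $f$ is not strong: $x\dashv f$ for all $x\in X$ and $f\vdash[u]_{|u|}$ for all $u\in X^+$. 2) If $w=\widetilde f=a\widetilde gb$, $a,b\in X^*$: if $p(\overline f)\in P([agb])$, $f-[agb]_{p(\overline f)}$; if $p(\overline f)\notin P([agb])$ and both $f,g$ are strong, for every $x\in X$, $[xf]_1-[xagb]_1$ and $[fx]_{|wx|}-[agbx]_{|wx|}$. 3) If $w=\widetilde fb=a\widetilde g$, $a,b\in X^*$, $|\widetilde f|+|\widetilde g|>|w|$: if $P([fb])\cap P([ag])\ne\varnothing$, for every $m$ in it $[fb]_m-[ag]_m$; if $P([fb])\cap P([ag])=\varnothing$ and both $f,g$ are strong, for every $x\in X$, $[xfb]_1-[xag]_1$ and $[fbx]_{|wx|}-[agx]_{|wx|}$. $h$ is trivial modulo $S$ if $h=\sum\alpha_i[a_is_ib_i]_{m_i}$ is a finite sum with $\alpha_i\in\mathbf{k}$, $[a_is_ib_i]_{m_i}$ normal $S$-diwords and $\overline{[a_is_ib_i]_{m_i}}\le\overline h$. A monic set $S$ is a Gröbner-Shirshov basis in $Di\langle X\rangle$ if every composition of elements of $S$ is trivial modulo $S$. *)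

(* Defs.v *)
From HB Require Import structures.
From mathcomp Require Import all_boot all_order all_algebra generic_quotient.
From mathcomp Require Import ring_quotient.
From mathcomp Require Import boolp classical_sets wochoice.
From mathcomp Require Import freeg.

Set Implicit Arguments.
Unset Strict Implicit.
Unset Printing Implicit Defensive.

Import Order.TTheory GRing.Theory.
Local Open Scope classical_set_scope.
Local Open Scope quotient_scope.
Local Open Scope ring_scope.

Declare Scope di_scope.
Delimit Scope di_scope with di.
Local Open Scope di_scope.

HB.mixin Record Choice_isDisemigroup D of Choice D := {
  svdash : D -> D -> D;
  sdashv : D -> D -> D;
  svdashA : associative svdash;
  sdashvA : associative sdashv;
  sdashv_vdash : forall a b c, sdashv a (svdash b c) = sdashv a (sdashv b c);
  svdash_dashv : forall a b c, svdash (sdashv a b) c = svdash (svdash a b) c;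
  svdash_dashvA : forall a b c, svdash a (sdashv b c) = sdashv (svdash a b) c
}.

#[short(type="disemigroupType")]
HB.structure Definition Disemigroup := {D of Choice_isDisemigroup D & Choice D}.

HB.mixin Record Lmodule_isDialgebra (K : fieldType) D of GRing.Lmodule K D := {
  vdash : D -> D -> D;
  dashv : D -> D -> D;
  vdash_linearl : forall (c : K) x y z,
    vdash (c *: x + y) z = c *: vdash x z + vdash y z;
  vdash_linearr : forall (c : K) z x y,
    vdash z (c *: x + y) = c *: vdash z x + vdash z y;
  dashv_linearl : forall (c : K) x y z,
    dashv (c *: x + y) z = c *: dashv x z + dashv y z;
  dashv_linearr : forall (c : K) z x y,
    dashv z (c *: x + y) = c *: dashv z x + dashv z y;
  vdashA : associative vdash;
  dashvA : associative dashv;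
  dashv_vdash : forall a b c, dashv a (vdash b c) = dashv a (dashv b c);
  vdash_dashv : forall a b c, vdash (dashv a b) c = vdash (vdash a b) c;
  vdash_dashvA : forall a b c, vdash a (dashv b c) = dashv (vdash a b) c
}.

#[short(type="dialgebraType")]
HB.structure Definition Dialgebra (K : fieldType) :=
  {D of Lmodule_isDialgebra K D & GRing.Lmodule K D}.

Notation "a ⊢ b" := (vdash a b) (at level 40, left associativity) : di_scope.
Notation "a ⊣ b" := (dashv a b) (at level 40, left associativity) : di_scope.

Section DisgpQuotient.
Variable D : disemigroupType.
Implicit Types (R P : set (D * D)).

Definition is_congruence R : Prop :=
  [/\ forall a, R (a, a),
      forall a b, R (a, b) -> R (b, a),
      forall a b c, R (a, b) -> R (b, c) -> R (a, c) &
      forall a b c, R (a, b) ->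
        [/\ R (svdash a c, svdash b c), R (svdash c a, svdash c b),
            R (sdashv a c, sdashv b c) & R (sdashv c a, sdashv c b)]].

Definition congr_gen P : set (D * D) := smallest is_congruence P.

Lemma congr_genP P ab :
  congr_gen P ab <-> forall R, is_congruence R -> P `<=` R -> R ab.
Proof. by split=> [Pab R cR PR|Pab R [cR PR]]; apply: Pab. Qed.

Lemma congr_gen_congruence P : is_congruence (congr_gen P).
Proof.
split=> [a|a b /congr_genP Rab|a b c /congr_genP Rab /congr_genP Rbc|
         a b c /congr_genP Rab].
- by apply/congr_genP=> R [].
- apply/congr_genP=> R cR PR; case: (cR) => _ sR _ _.
  by apply: sR; apply: Rab.
- apply/congr_genP=> R cR PR; case: (cR) => _ _ tR _.
  by apply: (tR _ b); [apply: Rab|apply: Rbc].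
- by split; apply/congr_genP=> R cR PR;
    case: (cR) => _ _ _ /(_ a b c (Rab _ cR PR)) [].
Qed.

Definition congr_rel P : rel D := fun a b => (a, b) \in congr_gen P.

Lemma congr_relP P a b : reflect (congr_gen P (a, b)) (congr_rel P a b).
Proof. by apply: (iffP idP) => [/set_mem|/mem_set]. Qed.

Lemma congr_rel_equiv P : equiv_class_of (congr_rel P).
Proof.
have [r s t _] := congr_gen_congruence P.
split=> [a|a b|b a c]; first exact/congr_relP.
- by apply/congr_relP/congr_relP; apply: s.
- by move=> /congr_relP ab /congr_relP bc; apply/congr_relP; apply: (t _ b).
Qed.

Canonical congr_equiv P := EquivRelPack (congr_rel_equiv P).
Canonical congr_encModRel P := defaultEncModRel (congr_rel P).

Definition disgp_quot P := {eq_quot congr_rel P}.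
HB.instance Definition _ P : EqQuotient D (congr_rel P) (disgp_quot P) :=
  EqQuotient.on (disgp_quot P).
HB.instance Definition _ P := Choice.on (disgp_quot P).

Variable P : set (D * D).
Local Notation Q := (disgp_quot P).

Definition qsvdash := lift_op2 Q (@svdash D).
Definition qsdashv := lift_op2 Q (@sdashv D).

Lemma congr_repr a : congr_gen P (a, repr (\pi_Q a)).
Proof. by apply/congr_relP; rewrite -eqmodE reprK. Qed.

Lemma pi_svdash : {morph \pi_Q : a b / svdash a b >-> qsvdash a b}.
Proof.
have [_ _ t c] := congr_gen_congruence P.
move=> a b; unlock qsvdash; apply/eqmodP/congr_relP.
apply: (t _ (svdash (repr (\pi_Q a)) b)).
- by have [] := c _ _ b (congr_repr a).
- by have [] := c _ _ (repr (\pi_Q a)) (congr_repr b).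
Qed.
Canonical pi_svdash_morph := PiMorph2 pi_svdash.

Lemma pi_sdashv : {morph \pi_Q : a b / sdashv a b >-> qsdashv a b}.
Proof.
have [_ _ t c] := congr_gen_congruence P.
move=> a b; unlock qsdashv; apply/eqmodP/congr_relP.
apply: (t _ (sdashv (repr (\pi_Q a)) b)).
- by have [] := c _ _ b (congr_repr a).
- by have [] := c _ _ (repr (\pi_Q a)) (congr_repr b).
Qed.
Canonical pi_sdashv_morph := PiMorph2 pi_sdashv.

Lemma qsvdashA : associative qsvdash.
Proof.
by move=> x y z; rewrite -[x]reprK -[y]reprK -[z]reprK !piE svdashA.
Qed.

Lemma qsdashvA : associative qsdashv.
Proof.
by move=> x y z; rewrite -[x]reprK -[y]reprK -[z]reprK !piE sdashvA.
Qed.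

Lemma qsdashv_vdash a b c : qsdashv a (qsvdash b c) = qsdashv a (qsdashv b c).
Proof. by rewrite -[a]reprK -[b]reprK -[c]reprK !piE sdashv_vdash. Qed.

Lemma qsvdash_dashv a b c : qsvdash (qsdashv a b) c = qsvdash (qsvdash a b) c.
Proof. by rewrite -[a]reprK -[b]reprK -[c]reprK !piE svdash_dashv. Qed.

Lemma qsvdash_dashvA a b c : qsvdash a (qsdashv b c) = qsdashv (qsvdash a b) c.
Proof. by rewrite -[a]reprK -[b]reprK -[c]reprK !piE svdash_dashvA. Qed.

HB.instance Definition _ := Choice_isDisemigroup.Build Q
  qsvdashA qsdashvA qsdashv_vdash qsvdash_dashv qsvdash_dashvA.

End DisgpQuotient.

Section DialgebraQuotient.
Variables (K : fieldType) (D : dialgebraType K).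
Implicit Types (I S : set D) (f g h : D).

Definition is_ideal I : Prop :=
  [/\ I 0,
      forall (c : K) f g, I f -> I g -> I (c *: f + g) &
      forall f g, I f -> [/\ I (f ⊢ g), I (g ⊢ f), I (f ⊣ g) & I (g ⊣ f)]].

Lemma vdashBl f g h : (f - g) ⊢ h = f ⊢ h - g ⊢ h.
Proof. by rewrite addrC -scaleN1r vdash_linearl scaleN1r addrC. Qed.

Lemma vdashBr h f g : h ⊢ (f - g) = h ⊢ f - h ⊢ g.
Proof. by rewrite addrC -scaleN1r vdash_linearr scaleN1r addrC. Qed.

Lemma dashvBl f g h : (f - g) ⊣ h = f ⊣ h - g ⊣ h.
Proof. by rewrite addrC -scaleN1r dashv_linearl scaleN1r addrC. Qed.

Lemma dashvBr h f g : h ⊣ (f - g) = h ⊣ f - h ⊣ g.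
Proof. by rewrite addrC -scaleN1r dashv_linearr scaleN1r addrC. Qed.

Definition Id S : set D := smallest is_ideal S.

Lemma IdP S f : Id S f <-> forall I, is_ideal I -> S `<=` I -> I f.
Proof. by split=> [Sf I iI SI|Sf I [iI SI]]; apply: Sf. Qed.

Lemma Id_ideal S : is_ideal (Id S).
Proof.
split=> [|c f g /IdP If /IdP Ig|f g /IdP If].
- by apply/IdP=> I [].
- apply/IdP=> I iI SI; case: (iI) => _ iD _.
  by apply: iD; [apply: If|apply: Ig].
- by split; apply/IdP=> I iI SI; case: (iI) => _ _ /(_ f g (If _ iI SI)) [].
Qed.

Definition Id_pred S : {pred D} := fun f => f \in Id S.

Lemma Id_predP S f : reflect (Id S f) (Id_pred S f).
Proof. by apply: (iffP idP) => [/set_mem|/mem_set]. Qed.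

Lemma Id_zmod_closed S : zmod_closed (Id_pred S).
Proof.
have [i0 iD _] := Id_ideal S; split=> [|f g /Id_predP If /Id_predP Ig].
  exact/Id_predP.
by apply/Id_predP; rewrite addrC -scaleN1r; apply: iD.
Qed.
HB.instance Definition _ S := GRing.isZmodClosed.Build D (Id_pred S)
  (Id_zmod_closed S).

Definition dquot S := Quotient.quot (GRing.ZmodClosed.clone D (Id_pred S) _).
HB.instance Definition _ S := GRing.Zmodule.on (dquot S).
HB.instance Definition _ S := EqQuotient.on (dquot S).

Variable S : set D.
Local Notation Q := (dquot S).

Lemma dquotP f g : reflect (Id S (f - g)) (\pi_Q f == \pi_Q g).
Proof. by rewrite -Quotient.idealrBE; apply: Id_predP. Qed.

Lemma dquot_repr f : Id S (repr (\pi_Q f) - f).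
Proof. by apply/dquotP; rewrite reprK. Qed.

Definition qscale (c : K) := lift_op1 Q ( *:%R c).
Definition qvdash := lift_op2 Q (@vdash K D).
Definition qdashv := lift_op2 Q (@dashv K D).

Lemma pi_qscale c : {morph \pi_Q : f / c *: f >-> qscale c f}.
Proof.
move=> f; unlock qscale; apply/esym/eqP/dquotP; rewrite -scalerBr.
have [i0 iD _] := Id_ideal S; rewrite -[_ *: _]addr0.
by apply: iD => //; apply: dquot_repr.
Qed.

Lemma pi_qvdash : {morph \pi_Q : f g / f ⊢ g >-> qvdash f g}.
Proof.
move=> f g; unlock qvdash; apply/esym/eqP/dquotP.
have [i0 iD iM] := Id_ideal S.
set f' := repr _; set g' := repr _.
have -> : f' ⊢ g' - f ⊢ g = 1 *: ((f' - f) ⊢ g') + f ⊢ (g' - g).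
  by rewrite scale1r vdashBl vdashBr addrA subrK.
apply: iD.
- by have [] := iM _ g' (dquot_repr f).
- by have [] := iM _ f (dquot_repr g).
Qed.

Lemma pi_qdashv : {morph \pi_Q : f g / f ⊣ g >-> qdashv f g}.
Proof.
move=> f g; unlock qdashv; apply/esym/eqP/dquotP.
have [i0 iD iM] := Id_ideal S.
set f' := repr _; set g' := repr _.
have -> : f' ⊣ g' - f ⊣ g = 1 *: ((f' - f) ⊣ g') + f ⊣ (g' - g).
  by rewrite scale1r dashvBl dashvBr addrA subrK.
apply: iD.
- by have [] := iM _ g' (dquot_repr f).
- by have [] := iM _ f (dquot_repr g).
Qed.

Let piD : {morph \pi_Q : f g / f + g >-> f + g}.
Proof. by move=> f g; rewrite !piE. Qed.

Lemma qscaleA c d x : qscale c (qscale d x) = qscale (c * d) x.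
Proof. by rewrite -[x]reprK -!pi_qscale scalerA. Qed.

Lemma qscale1 : left_id 1 qscale.
Proof. by move=> x; rewrite -[x]reprK -pi_qscale scale1r. Qed.

Lemma qscaleDr : right_distributive qscale +%R.
Proof.
move=> c x y; rewrite -[x]reprK -[y]reprK.
by rewrite -piD -!pi_qscale -piD scalerDr.
Qed.

Lemma qscaleDl x : {morph qscale^~ x : c d / c + d}.
Proof. by move=> c d; rewrite -[x]reprK -!pi_qscale -piD scalerDl. Qed.

HB.instance Definition _ := GRing.Zmodule_isLmodule.Build K Q
  qscaleA qscale1 qscaleDr qscaleDl.

Let piZ c f : \pi_Q (c *: f) = c *: \pi_Q f.
Proof. exact: pi_qscale. Qed.

Let qE := (piD, piZ, pi_qvdash, pi_qdashv).

Lemma qvdash_linearl (c : K) (x y z : Q) :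
  qvdash (c *: x + y) z = c *: qvdash x z + qvdash y z.
Proof. by rewrite -[x]reprK -[y]reprK -[z]reprK -!qE vdash_linearl. Qed.

Lemma qvdash_linearr (c : K) (z x y : Q) :
  qvdash z (c *: x + y) = c *: qvdash z x + qvdash z y.
Proof. by rewrite -[x]reprK -[y]reprK -[z]reprK -!qE vdash_linearr. Qed.

Lemma qdashv_linearl (c : K) (x y z : Q) :
  qdashv (c *: x + y) z = c *: qdashv x z + qdashv y z.
Proof. by rewrite -[x]reprK -[y]reprK -[z]reprK -!qE dashv_linearl. Qed.

Lemma qdashv_linearr (c : K) (z x y : Q) :
  qdashv z (c *: x + y) = c *: qdashv z x + qdashv z y.
Proof. by rewrite -[x]reprK -[y]reprK -[z]reprK -!qE dashv_linearr. Qed.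

Lemma qvdashA : associative qvdash.
Proof. by move=> x y z; rewrite -[x]reprK -[y]reprK -[z]reprK -!qE vdashA. Qed.

Lemma qdashvA : associative qdashv.
Proof. by move=> x y z; rewrite -[x]reprK -[y]reprK -[z]reprK -!qE dashvA. Qed.

Lemma qdashv_vdash x y z : qdashv x (qvdash y z) = qdashv x (qdashv y z).
Proof. by rewrite -[x]reprK -[y]reprK -[z]reprK -!qE dashv_vdash. Qed.

Lemma qvdash_dashv x y z : qvdash (qdashv x y) z = qvdash (qvdash x y) z.
Proof. by rewrite -[x]reprK -[y]reprK -[z]reprK -!qE vdash_dashv. Qed.

Lemma qvdash_dashvA x y z : qvdash x (qdashv y z) = qdashv (qvdash x y) z.
Proof. by rewrite -[x]reprK -[y]reprK -[z]reprK -!qE vdash_dashvA. Qed.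

HB.instance Definition _ := Lmodule_isDialgebra.Build K Q
  qvdash_linearl qvdash_linearr qdashv_linearl qdashv_linearr
  qvdashA qdashvA qdashv_vdash qvdash_dashv qvdash_dashvA.

End DialgebraQuotient.

Definition is_basis (K : fieldType) (V : lmodType K) (J : eqType)
    (B : set J) (e : J -> V) : Prop :=
  [/\ forall i j, B i -> B j -> e i = e j -> i = j,
      forall (s : seq J) (c : J -> K), uniq s -> (forall i, i \in s -> B i) ->
        \sum_(i <- s) c i *: e i = 0 -> forall i, i \in s -> c i = 0 &
      forall v, exists (s : seq J) (c : J -> K),
        (forall i, i \in s -> B i) /\ v = \sum_(i <- s) c i *: e i].

Definition word (X : Type) : Type := seq X.
HB.instance Definition _ (X : choiceType) := Choice.on (word X).

Section DegLex.
Variables (disp : Order.disp_t) (X : orderType disp).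

(* [seqlexi] compares words lexicographically from the left, and [*l] is the
   lexicographic product: lengths are compared first. *)
Definition deglex_key (u : word X) : nat *l seqlexi X := (size u, u).
Definition deglex (u v : word X) : bool := (deglex_key u <= deglex_key v)%O.

Lemma deglex_refl : reflexive deglex. Proof. by move=> u; apply: lexx. Qed.

Lemma deglex_anti : antisymmetric deglex.
Proof. by move=> u v /le_anti[]. Qed.

Lemma deglex_trans : transitive deglex.
Proof. by move=> v u w; apply: le_trans. Qed.

Lemma deglex_total : total deglex.
Proof. by move=> u v; apply: le_total. Qed.

Fact deglex_display : Order.disp_t. Proof. exact: Order.Disp tt tt. Qed.
HB.instance Definition _ := Order.Le_isPOrder.Build deglex_display (word X)
  deglex_refl deglex_anti deglex_trans.
HB.instance Definition _ := Order.POrder_isTotal.Build deglex_display (word X)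
  deglex_total.

(* [u]_m is the pair (u, m); positions are counted from 1. *)
Definition is_normal (d : word X *l nat) : bool := (0 < d.2 <= size d.1)%N.

Record diword := Diword { diword_val : word X *l nat; _ : is_normal diword_val }.
HB.instance Definition _ := [isSub for diword_val].
HB.instance Definition _ := [Choice of diword by <:].
Fact deglexcenter_display : Order.disp_t.
Proof. exact: Order.Disp tt tt. Qed.
HB.instance Definition _ :=
  [SubChoice_isSubOrder of diword by <: with deglexcenter_display].

Definition dword (d : diword) : word X := (val d).1.
Definition center (d : diword) : nat := (val d).2.

Lemma center_gt0 d : (0 < center d)%N.
Proof. by have /andP[] := valP d. Qed.

Lemma center_le d : (center d <= size (dword d))%N.
Proof. by have /andP[] := valP d. Qed.

Lemma diword_eq d e : dword d = dword e -> center d = center e -> d = e.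
Proof.
case: d e => [[u m] hd] [[v n] he]; rewrite /dword /center /= => uv mn.
by apply: val_inj; rewrite /= uv mn.
Qed.

Lemma diword_vdash_subproof d e :
  is_normal (dword d ++ dword e, size (dword d) + center e)%N.
Proof.
by rewrite /is_normal /= size_cat leq_add2l center_le addn_gt0 center_gt0 orbT.
Qed.

Lemma diword_dashv_subproof d e : is_normal (dword d ++ dword e, center d).
Proof.
rewrite /is_normal /= size_cat center_gt0 /=.
exact: leq_trans (center_le d) (leq_addr _ _).
Qed.

Definition diword_vdash d e : diword := Diword (diword_vdash_subproof d e).
Definition diword_dashv d e : diword := Diword (diword_dashv_subproof d e).

Lemma diword_vdashA : associative diword_vdash.
Proof.
by move=> a b c; apply: diword_eq; rewrite /dword /center /= ?catA // size_cat addnA.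
Qed.

Lemma diword_dashvA : associative diword_dashv.
Proof. by move=> a b c; apply: diword_eq; rewrite /dword /center /= ?catA. Qed.

Lemma diword_dashv_vdash a b c :
  diword_dashv a (diword_vdash b c) = diword_dashv a (diword_dashv b c).
Proof. exact: diword_eq. Qed.

Lemma diword_vdash_dashv a b c :
  diword_vdash (diword_dashv a b) c = diword_vdash (diword_vdash a b) c.
Proof. exact: diword_eq. Qed.

Lemma diword_vdash_dashvA a b c :
  diword_vdash a (diword_dashv b c) = diword_dashv (diword_vdash a b) c.
Proof. by apply: diword_eq; rewrite /dword /center /= ?catA. Qed.

HB.instance Definition _ := Choice_isDisemigroup.Build diword
  diword_vdashA diword_dashvA diword_dashv_vdash diword_vdash_dashv
  diword_vdash_dashvA.
End DegLex.

Section FreeDialgebra.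
Variables (K : fieldType) (disp : Order.disp_t) (X : orderType disp).

Local Notation Di := {freeg (diword X) / K}.
Implicit Types (f g h : Di) (d e : diword X).

Definition bilin (op : diword X -> diword X -> diword X) f g : Di :=
  \sum_(d <- dom f) \sum_(e <- dom g) << coeff d f * coeff e g *g op d e >>.

Lemma sum_domw (A : seq (diword X)) f (F : diword X -> K -> Di) :
  uniq A -> {subset dom f <= A} -> (forall d, F d 0 = 0) ->
  \sum_(d <- dom f) F d (coeff d f) = \sum_(d <- A) F d (coeff d f).
Proof.
move=> uA fA F0; rewrite [RHS](bigID (mem (dom f))) /= [X in _ + X]big1 ?addr0.
  rewrite -[RHS]big_filter; apply: perm_big; apply: uniq_perm.
  - exact: uniq_dom.
  - exact: filter_uniq.
  - by move=> d; rewrite mem_filter; case fd: (d \in dom f); rewrite //= fA.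
by move=> d /coeff_outdom ->.
Qed.

Lemma bilinEw op (A B : seq (diword X)) f g :
  uniq A -> uniq B -> {subset dom f <= A} -> {subset dom g <= B} ->
  bilin op f g =
    \sum_(d <- A) \sum_(e <- B) << coeff d f * coeff e g *g op d e >>.
Proof.
move=> uA uB fA gB; rewrite /bilin.
rewrite (sum_domw
  (F := fun d c => \sum_(e <- dom g) << c * coeff e g *g op d e >>) uA fA).
  apply: eq_bigr => d _.
  rewrite (sum_domw (F := fun e c => << coeff d f * c *g op d e >>) uB gB) //.
  by move=> e; rewrite mulr0 freegU0.
by move=> d; rewrite big1 // => e _; rewrite mul0r freegU0.
Qed.

Lemma bilinUU op d e : bilin op << d >> << e >> = << op d e >>.
Proof. by rewrite /bilin !domU1 !big_seq1 !coeffU !eqxx !mulr1. Qed.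

Lemma freegUZ (c a : K) d : << c * a *g d >> = c *: (<< a *g d >> : Di).
Proof. by apply/eqP/freeg_eqP=> k; rewrite coeffZ !coeffU mulrA. Qed.

Lemma dom_linear (c : K) f g :
  {subset dom (c *: f + g) <= undup (dom f ++ dom g)}.
Proof.
move=> d /domD_subset; rewrite mem_undup !mem_cat => /orP[/domZ_subset ->//|->].
exact: orbT.
Qed.

Lemma bilin_linearl op (c : K) f g h :
  bilin op (c *: f + g) h = c *: bilin op f h + bilin op g h.
Proof.
pose A := undup (dom f ++ dom g).
have uA : uniq A by apply: undup_uniq.
have fA : {subset dom f <= A} by move=> d fd; rewrite mem_undup mem_cat fd.
have gA : {subset dom g <= A} by move=> d gd; rewrite mem_undup mem_cat gd orbT.
have uh := uniq_dom h.
rewrite (bilinEw op uA uh (dom_linear (g := g)) (fun _ => id)).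
rewrite (bilinEw op uA uh fA (fun _ => id)) (bilinEw op uA uh gA (fun _ => id)).
rewrite scaler_sumr -big_split; apply: eq_bigr => d _ /=.
rewrite scaler_sumr -big_split; apply: eq_bigr => e _ /=.
by rewrite coeffD coeffZ mulrDl -mulrA -freegUD freegUZ.
Qed.

Lemma bilin_linearr op (c : K) h f g :
  bilin op h (c *: f + g) = c *: bilin op h f + bilin op h g.
Proof.
pose A := undup (dom f ++ dom g).
have uA : uniq A by apply: undup_uniq.
have fA : {subset dom f <= A} by move=> d fd; rewrite mem_undup mem_cat fd.
have gA : {subset dom g <= A} by move=> d gd; rewrite mem_undup mem_cat gd orbT.
have uh := uniq_dom h.
rewrite (bilinEw op uh uA (fun _ => id) (dom_linear (g := g))).
rewrite (bilinEw op uh uA (fun _ => id) fA) (bilinEw op uh uA (fun _ => id) gA).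
rewrite scaler_sumr -big_split; apply: eq_bigr => d _ /=.
rewrite scaler_sumr -big_split; apply: eq_bigr => e _ /=.
by rewrite coeffD coeffZ mulrDr mulrCA -freegUD freegUZ.
Qed.

Lemma Di_ind (P : Di -> Prop) :
  P 0 -> (forall c d f, P f -> P (c *: << d >> + f)) -> forall f, P f.
Proof.
move=> P0 PD f; rewrite -[f]freeg_sumE.
elim: (X in \sum_(k <- X) _) => [|d s IH]; first by rewrite big_nil.
by rewrite big_cons -[coeff d f]mulr1 freegUZ; apply: PD.
Qed.

Definition trilinear (F : Di -> Di -> Di -> Di) : Prop :=
  [/\ forall (c : K) f f' g h, F (c *: f + f') g h = c *: F f g h + F f' g h,
      forall (c : K) f g g' h, F f (c *: g + g') h = c *: F f g h + F f g' h &
      forall (c : K) f g h h', F f g (c *: h + h') = c *: F f g h + F f g h'].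

Lemma trilinear_ext F G : trilinear F -> trilinear G ->
  (forall a b c, F << a >> << b >> << c >> = G << a >> << b >> << c >>) ->
  forall f g h, F f g h = G f g h.
Proof.
move=> [F1 F2 F3] [G1 G2 G3] FG f g h.
have lin0 (L : Di -> Di) :
    (forall (c : K) x y, L (c *: x + y) = c *: L x + L y) -> L 0 = 0.
  by move=> /(_ (-1) 0 0); rewrite !scaleN1r oppr0 addr0 addNr.
elim/Di_ind: f => [|c d f IH]; last first.
  apply: etrans (F1 c << d >> f g h) (etrans _ (esym (G1 c << d >> f g h))).
  congr (_ *: _ + _); last exact: IH.
  elim/Di_ind: g {IH} => [|b e g IH]; last first.
    apply: etrans (F2 b _ << e >> g h) (etrans _ (esym (G2 b _ << e >> g h))).
    congr (_ *: _ + _); last exact: IH.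
    elim/Di_ind: h {IH} => [|a i h IH]; last first.
      apply: etrans (F3 a _ _ << i >> h) (etrans _ (esym (G3 a _ _ << i >> h))).
      by congr (_ *: _ + _); [apply: FG|apply: IH].
    by rewrite (lin0 (F _ _)) ?(lin0 (G _ _)).
  by rewrite (lin0 (fun x => F _ x h)) ?(lin0 (fun x => G _ x h)).
by rewrite (lin0 (fun x => F x g h)) ?(lin0 (fun x => G x g h)).
Qed.

Lemma bilinR_trilinear op1 op2 :
  trilinear (fun f g h => bilin op1 f (bilin op2 g h)).
Proof.
split=> c f g h i.
- exact: bilin_linearl.
- by rewrite bilin_linearl; apply: bilin_linearr.
- by rewrite (bilin_linearr op2 c); apply: bilin_linearr.
Qed.

Lemma bilinL_trilinear op1 op2 :
  trilinear (fun f g h => bilin op1 (bilin op2 f g) h).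
Proof.
split=> c f g h i.
- by rewrite (bilin_linearl op2 c); apply: bilin_linearl.
- by rewrite (bilin_linearr op2 c); apply: bilin_linearl.
- exact: bilin_linearr.
Qed.

Lemma bilin_ext_assoc op1 op2 op3 op4 :
  (forall a b c, op1 a (op2 b c) = op3 (op4 a b) c) ->
  forall f g h, bilin op1 f (bilin op2 g h) = bilin op3 (bilin op4 f g) h.
Proof.
move=> opE f g h.
apply: (trilinear_ext (bilinR_trilinear op1 op2) (bilinL_trilinear op3 op4)) => a b c.
by rewrite !bilinUU opE.
Qed.

Lemma bilin_ext_r op1 op2 op3 op4 :
  (forall a b c, op1 a (op2 b c) = op3 a (op4 b c)) ->
  forall f g h, bilin op1 f (bilin op2 g h) = bilin op3 f (bilin op4 g h).
Proof.
move=> opE f g h.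
apply: (trilinear_ext (bilinR_trilinear op1 op2) (bilinR_trilinear op3 op4)) => a b c.
by rewrite !bilinUU opE.
Qed.

Lemma bilin_ext_l op1 op2 op3 op4 :
  (forall a b c, op1 (op2 a b) c = op3 (op4 a b) c) ->
  forall f g h, bilin op1 (bilin op2 f g) h = bilin op3 (bilin op4 f g) h.
Proof.
move=> opE f g h.
apply: (trilinear_ext (bilinL_trilinear op1 op2) (bilinL_trilinear op3 op4)) => a b c.
by rewrite !bilinUU opE.
Qed.

HB.instance Definition _ := Lmodule_isDialgebra.Build K Di
  (bilin_linearl (@svdash (diword X))) (bilin_linearr (@svdash (diword X)))
  (bilin_linearl (@sdashv (diword X))) (bilin_linearr (@sdashv (diword X)))
  (bilin_ext_assoc (@svdashA (diword X))) (bilin_ext_assoc (@sdashvA (diword X)))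
  (bilin_ext_r sdashv_vdash) (bilin_ext_l svdash_dashv)
  (bilin_ext_assoc svdash_dashvA).

End FreeDialgebra.

Notation Di K X := {freeg (diword X) / K}.

Section GroebnerShirshov.
Variables (K : fieldType) (disp : Order.disp_t) (X : orderType disp).
Local Notation Di := (Di K X).
Implicit Types (f g h s : Di) (S : set Di) (d : diword X).
Implicit Types (a b u v w : word X) (x y : X) (l m n : nat).

(* [u]_m as an element of [Di]; only used when [1 <= m <= size u]. *)
Definition dpoly u m : Di := if insub (u, m) is Some d then << d >> else 0.

(* [None] stands for the conventional value [0], smaller than every diword. *)
Definition lead f : option (diword X) := ohead (sort >=%O (dom f)).

Definition lead_le (o1 o2 : option (diword X)) : bool :=
  match o1, o2 with
  | None, _ => true
  | Some _, None => false
  | Some d1, Some d2 => (d1 <= d2)%O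
  end.

Definition lc f : K := if lead f is Some d then coeff d f else 0.
Definition lt f : Di := if lead f is Some d then << lc f *g d >> else 0.
Definition rest f : Di := f - lt f.

(* The empty word, which is below every nonempty word and underlies no diword,
   stands for the conventional value [0]. *)
Definition tilde f : word X := if lead f is Some d then dword d else [::].
Definition pcenter f : nat := if lead f is Some d then center d else 0%N.

Definition monic f : bool := lc f == 1.
Definition strong f : bool := (tilde (rest f) < tilde f)%O.

Definition Pset a s b l : bool :=
  [|| strong s && (1 <= l <= size a)%N,
      l == (size a + pcenter s)%N |
      strong s &&
        (size (a ++ tilde s) < l <= size (a ++ tilde s ++ b))%N].

Definition lvdash a l f : Di := if a is [::] then f else dpoly a l ⊢ f.
Definition ldashv a l f : Di := if a is [::] then f else dpoly a l ⊣ f.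
Definition rvdash f b l : Di := if b is [::] then f else f ⊢ dpoly b l.
Definition rdashv f b l : Di := if b is [::] then f else f ⊣ dpoly b l.

(* The normal S-diword [asb]_l, meaningful when [Pset a s b l]. *)
Definition sdiword a s b l : Di :=
  if (l <= size a)%N then rdashv (ldashv a l s) b 1
  else if l == (size a + pcenter s)%N then rdashv (lvdash a (size a) s) b 1
  else rvdash (lvdash a (size a) s) b (l - size (a ++ tilde s)).

Variant composition f g : Di -> Prop :=
| CompLeft x of ~~ strong f : composition f g (dpoly [:: x] 1 ⊣ f)
| CompRight u of ~~ strong f & u != [::] :
    composition f g (f ⊢ dpoly u (size u))
| CompIncl a b of tilde f = a ++ tilde g ++ b & Pset a g b (pcenter f) :
    composition f g (f - sdiword a g b (pcenter f))
| CompInclLeft a b x of tilde f = a ++ tilde g ++ b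
    & ~~ Pset a g b (pcenter f) & strong f & strong g :
    composition f g (sdiword [:: x] f [::] 1 - sdiword (x :: a) g b 1)
| CompInclRight a b x of tilde f = a ++ tilde g ++ b
    & ~~ Pset a g b (pcenter f) & strong f & strong g :
    composition f g
      (sdiword [::] f [:: x] (size (tilde f)).+1
       - sdiword a g (rcons b x) (size (tilde f)).+1)
| CompOverlap a b m of tilde f ++ b = a ++ tilde g
    & (size (tilde f ++ b) < size (tilde f) + size (tilde g))%N
    & Pset [::] f b m & Pset a g [::] m :
    composition f g (sdiword [::] f b m - sdiword a g [::] m)
| CompOverlapLeft a b x of tilde f ++ b = a ++ tilde g
    & (size (tilde f ++ b) < size (tilde f) + size (tilde g))%N
    & (forall m, ~~ (Pset [::] f b m && Pset a g [::] m))
    & strong f & strong g :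
    composition f g (sdiword [:: x] f b 1 - sdiword (x :: a) g [::] 1)
| CompOverlapRight a b x of tilde f ++ b = a ++ tilde g
    & (size (tilde f ++ b) < size (tilde f) + size (tilde g))%N
    & (forall m, ~~ (Pset [::] f b m && Pset a g [::] m))
    & strong f & strong g :
    composition f g
      (sdiword [::] f (rcons b x) (size (tilde f ++ b)).+1
       - sdiword a g [:: x] (size (tilde f ++ b)).+1).

Definition trivial_mod S h : Prop :=
  exists (k : nat) (c : 'I_k -> K) (a b : 'I_k -> word X) (s : 'I_k -> Di)
         (m : 'I_k -> nat),
    (forall i, [/\ S (s i), Pset (a i) (s i) (b i) (m i) &
       lead_le (lead (sdiword (a i) (s i) (b i) (m i))) (lead h)]) /\
    h = \sum_(i < k) c i *: sdiword (a i) (s i) (b i) (m i).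

Definition is_GSbasis S : Prop :=
  (forall s, S s -> monic s) /\
  (forall f g h, S f -> S g -> composition f g h -> trivial_mod S h).

End GroebnerShirshov.

Section RightCommutative.
Variables (K : fieldType) (disp : Order.disp_t) (X : orderType disp).
Local Notation Di := (Di K X).

Definition rcomm_pairs : set (diword X * diword X) := [set pq |
  exists w v u : diword X,
    pq = (sdashv (sdashv w v) u, sdashv (sdashv w u) v) \/
    pq = (svdash (svdash w v) u, svdash (svdash w u) v)].

Definition Tprime : set Di :=
  [set << pq.1 >> - << pq.2 >> | pq in rcomm_pairs].

(* Sorting letters: the word written with floor brackets. *)
Definition floor_word (u : word X) : word X := sort <=%O u.

Definition Sprime : set Di := [set f | f != 0 /\
  ((exists (u v : word X) (x : X), [/\ (2 <= size u)%N, (size v <= 1)%N &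
      f = dpoly K (v ++ x :: u) (size v).+1
          - dpoly K (v ++ x :: floor_word u) (size v).+1]) \/
   (exists (u v : word X) (x y : X), (1 <= size v)%N /\
      f = dpoly K (y :: v ++ x :: u) (size v).+2
          - dpoly K (y :: floor_word (v ++ x :: u)) 3%N))].

(* [behead]: the first letter of [xs] is exempt from the monotonicity. *)
Definition rcomm_normal : set (diword X) := [set d |
  (exists u xs : word X, [/\ (size u <= 1)%N, (1 <= size xs)%N,
     sorted <=%O (behead xs), dword d = u ++ xs & center d = (size u).+1]) \/
  (exists xs : word X, [/\ (3 <= size xs)%N,
     sorted <=%O (behead xs), dword d = xs & center d = 3%N])].

End RightCommutative.

Arguments Tprime K {disp} X.
Arguments Sprime K {disp} X.
Arguments rcomm_pairs {disp} X.
Arguments rcomm_normal {disp} X.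

(* Main.v *)
(** Right commutativity never moves the letters of [[u]_m] up to the center if
    [m <= 2], nor the first letter if [m >= 3]; every other letter can be
    permuted freely, and a center [m >= 3] can be put at any position [>= 3].
    Hence the congruence is the kernel of the idempotent map [nf] that sorts the
    movable letters and replaces [m] by [min m 3].  The elements of [S'] are
    exactly the nonzero [d - nf d], and [nf d <= d], so
    [f = \sum_d f_d (d - nf d)] whenever the linear extension [NF] of [nf] kills
    [f], and this is already a presentation of [f] by normal [S']-diwords whose
    leading diwords do not exceed that of [f].  Thus [Id T' = Id S' = ker NF],
    every composition is trivial, and the fixed points of [nf] form a basis. *)
Require Import Defs.
From HB Require Import structures.
From mathcomp Require Import all_boot all_order all_algebra generic_quotient.
From mathcomp Require Import ring_quotient.
From mathcomp Require Import boolp classical_sets wochoice.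
From mathcomp Require Import freeg.
From mathcomp Require Import zify.

Import Order.TTheory GRing.Theory.
Local Open Scope classical_set_scope.
Local Open Scope quotient_scope.
Local Open Scope ring_scope.

(** * Sorted words and the normal form map on diwords *)

Section NormalForm.
Set Implicit Arguments.
Unset Strict Implicit.
Local Open Scope nat_scope.
Context {disp : Order.disp_t} {X : orderType disp}.
Implicit Types (d e c : diword X) (u v s t : seq X).

(* [lia] does not identify the convertible spellings of the letter type in [size]. *)
Ltac size_lia := intros; change (@size _ ?u) with (@size X u) in *; lia.

(** The head of the sorted word is the least of the letters shared with [s]; if the heads agree,
    they cancel from the permutation and induction applies. *)
Lemma sorted_seqlexi_le s t :
  sorted <=%O t -> perm_eq t s -> ((t : seqlexi X) <= s)%O.
Proof.
elim: s t => [|x s IH] [|y t] //= st pts; first by have := perm_size pts.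
have yx : (y <= x)%O.
  have : x \in y :: t by rewrite (perm_mem pts) mem_head.
  rewrite inE => /predU1P[->//|xt].
  by have /allP/(_ _ xt) := order_path_min le_trans st.
rewrite lexi_cons yx /=; apply/implyP => xy.
have exy : x = y by apply/le_anti; rewrite xy yx.
apply: IH; first exact: path_sorted st.
by rewrite exy perm_cons in pts.
Qed.

Lemma seqlexi_cat2l u s t :
  ((s : seqlexi X) <= t)%O -> ((u ++ s : seqlexi X) <= u ++ t)%O.
Proof. by move=> st; elim: u => //= x u IH; rewrite lexi_cons lexx. Qed.

(* Number of leading letters of [u]_m that right commutativity cannot move. *)
Definition frozen m : nat := if m == 2 then 2 else 1.

Lemma frozen_minn m : frozen (minn m 3) = frozen m.
Proof. by rewrite /frozen; congr (if _ then _ else _); lia. Qed.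

Lemma frozen_gt0 m : (0 < frozen m)%N.
Proof. by rewrite /frozen; case: ifP. Qed.

Lemma frozen_le d : (frozen (center d) <= size (dword d))%N.
Proof.
have := center_gt0 d; have := center_le d; rewrite /frozen.
case: eqP => [->//|_]; size_lia.
Qed.

Definition nf_word m u := take (frozen m) u ++ sort <=%O (drop (frozen m) u).

Lemma perm_nf_word m u : perm_eq (nf_word m u) u.
Proof. by rewrite /nf_word -{3}(cat_take_drop (frozen m) u) perm_cat2l perm_sort. Qed.

Lemma nf_subproof d :
  is_normal (nf_word (center d) (dword d), minn (center d) 3).
Proof.
rewrite /is_normal /= (perm_size (perm_nf_word _ _)).
by have := center_gt0 d; have := center_le d; size_lia.
Qed.

Lemma take_nf_word d :
  take (frozen (center d)) (nf_word (center d) (dword d)) =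
  take (frozen (center d)) (dword d).
Proof. by rewrite /nf_word takel_cat ?take_takel // size_takel // frozen_le. Qed.

Definition nf d : diword X := Diword (nf_subproof d).

(** The kernel of [nf] without sorting, in terms that can be followed through a product. *)
Definition nf_eq d e : Prop :=
  [/\ minn (center d) 3 = minn (center e) 3,
      take (frozen (center d)) (dword d) = take (frozen (center d)) (dword e) &
      perm_eq (dword d) (dword e)].

Lemma nf_eqP d e : nf d = nf e <-> nf_eq d e.
Proof.
split=> [de|[mde tde pde]].
  have cde : minn (center d) 3 = minn (center e) 3 by exact: (congr1 (@center _ X) de).
  have wde : nf_word (center d) (dword d) = nf_word (center e) (dword e).
    exact: (congr1 (@dword _ X) de).
  have fde : frozen (center d) = frozen (center e).
    by rewrite -frozen_minn cde frozen_minn.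
  split=> //; last first.
    by rewrite -(permPl (perm_nf_word (center d) _)) wde perm_nf_word.
  have := congr1 (take (frozen (center d))) wde.
  by rewrite take_nf_word => ->; rewrite fde take_nf_word.
have fde : frozen (center d) = frozen (center e).
  by rewrite -frozen_minn mde frozen_minn.
apply: diword_eq; rewrite /dword /center /= -/(dword _) -/(center _) //.
rewrite /nf_word -fde tde; congr (_ ++ _).
apply/perm_sort_leP.
rewrite -(perm_cat2l (take (frozen (center d)) (dword e))) -{1}tde.
by rewrite !cat_take_drop.
Qed.

Lemma nf_id d : nf (nf d) = nf d.
Proof.
apply/nf_eqP; split.
- by rewrite /center /= -minnA minnn.
- by rewrite /center /= frozen_minn; exact: take_nf_word.
- exact: perm_nf_word.
Qed.

(** * Compatibility of the normal form with the disemigroup products *)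

Lemma nf_eq_take1 d e : nf_eq d e -> take 1 (dword d) = take 1 (dword e).
Proof.
move=> [_ tde _]; have f0 := frozen_gt0 (center d).
by rewrite -(take_takel _ f0) tde take_takel.
Qed.

Lemma dword_svdash d e : dword (svdash d e) = dword d ++ dword e.
Proof. by []. Qed.

Lemma dword_sdashv d e : dword (sdashv d e) = dword d ++ dword e.
Proof. by []. Qed.

Lemma center_svdash d e : center (svdash d e) = size (dword d) + center e.
Proof. by []. Qed.

Lemma center_sdashv d e : center (sdashv d e) = center d.
Proof. by []. Qed.

Definition diwordE := (dword_svdash, dword_sdashv, center_svdash, center_sdashv).

Lemma frozen_neq2 m : m != 2 -> frozen m = 1.
Proof. by rewrite /frozen => /negPf->. Qed.

Lemma nf_eq_svdashr d e c : nf_eq d e -> nf_eq (svdash d c) (svdash e c).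
Proof.
move=> nde; have [mde tde pde] := nde; have t1 := nf_eq_take1 nde.
have sde := perm_size pde.
have [d0 c0] := (center_gt0 d, center_gt0 c); have ld := center_le d.
rewrite /nf_eq !diwordE sde perm_cat2r; split=> //.
have [sd|sd] := leqP (size (dword d)) 1.
  suff -> : dword d = dword e by [].
  by rewrite -[LHS](take_oversize sd) t1 take_oversize // -sde.
by rewrite frozen_neq2 ?takel_cat -?sde //; size_lia.
Qed.

Lemma nf_eq_svdashl d e c : nf_eq d e -> nf_eq (svdash c d) (svdash c e).
Proof.
move=> nde; have [mde tde pde] := nde; have t1 := nf_eq_take1 nde.
have [d0 c0] := (center_gt0 d, center_gt0 c); have lc := center_le c.
rewrite /nf_eq !diwordE perm_cat2l; split=> //; first by size_lia.
have [m2|m2] := eqVneq (size (dword c) + center d) 2.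
  have sc : size (dword c) = 1 by size_lia.
  by rewrite m2 -[frozen 2]/2 !take_cat sc /= t1.
by rewrite frozen_neq2 // !takel_cat //; size_lia.
Qed.

Lemma nf_eq_sdashvr d e c : nf_eq d e -> nf_eq (sdashv d c) (sdashv e c).
Proof.
move=> [mde tde pde]; have fd := frozen_le d.
rewrite /nf_eq !diwordE perm_cat2r; split=> //.
by rewrite !takel_cat // -(perm_size pde).
Qed.

Lemma nf_eq_sdashvl d e c : nf_eq d e -> nf_eq (sdashv c d) (sdashv c e).
Proof.
move=> [_ _ pde]; have fc := frozen_le c.
by rewrite /nf_eq !diwordE perm_cat2l; split=> //; rewrite !takel_cat.
Qed.

Lemma nf_congruence : is_congruence [set p : diword X * diword X | nf p.1 = nf p.2].
Proof.
split=> [//|a b /= ->//|a b c /= -> //|a b c /= /nf_eqP nab].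
by split; apply/nf_eqP; [apply: nf_eq_svdashr|apply: nf_eq_svdashl|
  apply: nf_eq_sdashvr|apply: nf_eq_sdashvl].
Qed.

Lemma nf_rcomm_pairs (p : diword X * diword X) : rcomm_pairs X p -> nf p.1 = nf p.2.
Proof.
have pcat (w v u : word X) : perm_eq ((w ++ v) ++ u) ((w ++ u) ++ v).
  by rewrite -!catA perm_cat2l perm_catC.
move=> [w [v [u [->|->]]]] /=; apply/nf_eqP; rewrite /nf_eq !diwordE pcat;
  split=> //.
- by rewrite -!catA !takel_cat ?frozen_le.
- have := (center_gt0 u, center_gt0 v); have := (center_le w, center_le u).
  have := (center_gt0 w, center_le v); rewrite !size_cat.
  by move=> [? ?] [? ?] [? ?]; size_lia.
have [[w0 u0] v0] := (center_gt0 w, center_gt0 u, center_gt0 v).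
have [lw lv] := (center_le w, center_le v).
rewrite frozen_neq2 ?size_cat; last by size_lia.
by rewrite -!catA !takel_cat //; size_lia.
Qed.

Lemma congr_gen_nf d e : congr_gen (rcomm_pairs X) (d, e) -> nf d = nf e.
Proof.
move/congr_genP/(_ _ nf_congruence); apply=> -[a b] /=; exact: nf_rcomm_pairs.
Qed.

(** * The normal form against the deg-lex-center ordering *)

Lemma nf_word_le m u : ((nf_word m u : word X) <= u)%O.
Proof.
have -> : ((nf_word m u : word X) <= u)%O =
          (deglex_key (nf_word m u) <= deglex_key u)%O by [].
rewrite /deglex_key lexi_pair (perm_size (perm_nf_word m u)) lexx /=.
rewrite /nf_word -[X in (_ <= X)%O](cat_take_drop (frozen m) u).
apply/seqlexi_cat2l/sorted_seqlexi_le; last by rewrite perm_sort.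
exact: sort_le_sorted.
Qed.

Lemma nf_le d : (nf d <= d)%O.
Proof.
have -> : (nf d <= d)%O = (val (nf d) <= val d)%O by [].
have -> : val d = (dword d, center d) by rewrite /dword /center; case: (val d).
by rewrite lexi_pair /= nf_word_le /=; apply/implyP => _; rewrite leEnat geq_minl.
Qed.

Lemma rcomm_normalP d : rcomm_normal X d <-> nf d = d.
Proof.
have d0 := center_gt0 d; have ld := center_le d.
split=> [|<-].
  move=> nd; apply: diword_eq.
    change (nf_word (center d) (dword d) = dword d); rewrite /nf_word.
    case: nd => [[u [xs [u1 xs1 sxs -> ->]]]|[xs [_ sxs -> ->]]].
      case: u u1 => [|y [|]] // _; case: xs xs1 sxs => [|x xs] // _ sxs.
        by rewrite /frozen /= drop0 take0 sort_le_id.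
      by rewrite /frozen /= take0 drop0 sort_le_id.
    by case: xs sxs => [|x xs] //= sxs; rewrite take0 drop0 sort_le_id.
  change (minn (center d) 3 = center d).
  by case: nd => [[u [xs [u1 _ _ _ ->]]]|[xs [_ _ _ ->]]] //; size_lia.
have wd : dword (nf d) = nf_word (center d) (dword d) by [].
have cd : center (nf d) = minn (center d) 3 by [].
rewrite /rcomm_normal /= wd cd /nf_word.
move: (dword d) (center d) ld d0 => [|x u] [|[|[|m]]] //= um _.
- left; exists [::], (x :: sort <=%O u); split=> //=; last by rewrite take0 drop0.
  exact: sort_le_sorted.
- case: u um => [|y u] // _; left; exists [:: x], (y :: sort <=%O u).
  split=> //=; last by rewrite take0 drop0.
  exact: sort_le_sorted.
right; exists (x :: sort <=%O u); rewrite take0 drop0; split=> //=.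
- by rewrite size_sort; size_lia.
- exact: sort_le_sorted.
Qed.

Lemma nf_normal d : rcomm_normal X (nf d).
Proof. exact/rcomm_normalP/nf_id. Qed.

(** * Congruence of every diword to its normal form *)

Lemma ext_subproof d s : is_normal (dword d ++ s, center d).
Proof. by rewrite /is_normal /= size_cat center_gt0 (leq_trans (center_le d)) ?leq_addr. Qed.

Definition ext d s : diword X := Diword (ext_subproof d s).

Lemma last_centered_subproof x u : is_normal (x :: u, (size u).+1).
Proof. by rewrite /is_normal /=. Qed.

(** The iterated [svdash] product of the letters of [x :: u]. *)
Definition last_centered x u : diword X := Diword (last_centered_subproof x u).

Local Notation "d ≈ e" := (congr_gen (rcomm_pairs X) (d, e)) (at level 70).

Lemma rcomm_refl d : d ≈ d.
Proof. by have [+ _ _ _] := congr_gen_congruence (rcomm_pairs X). Qed.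

Lemma rcomm_sym d e : d ≈ e -> e ≈ d.
Proof. by have [_ + _ _] := congr_gen_congruence (rcomm_pairs X); apply. Qed.

Lemma rcomm_trans d e c : d ≈ e -> e ≈ c -> d ≈ c.
Proof. by have [_ _ + _] := congr_gen_congruence (rcomm_pairs X); apply. Qed.

Lemma rcomm_svdashr d e c : d ≈ e -> svdash d c ≈ svdash e c.
Proof.
move=> de; have [_ _ _ cong] := congr_gen_congruence (rcomm_pairs X).
by case: (cong _ _ c de).
Qed.

Lemma rcomm_sdashvr d e c : d ≈ e -> sdashv d c ≈ sdashv e c.
Proof.
move=> de; have [_ _ _ cong] := congr_gen_congruence (rcomm_pairs X).
by case: (cong _ _ c de).
Qed.

Lemma rcomm_sdashv (w v u : diword X) : sdashv (sdashv w v) u ≈ sdashv (sdashv w u) v.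
Proof. by apply/congr_genP => R _; apply; exists w, v, u; left. Qed.

Lemma rcomm_svdash (w v u : diword X) : svdash (svdash w v) u ≈ svdash (svdash w u) v.
Proof. by apply/congr_genP => R _; apply; exists w, v, u; right. Qed.

(** Permutations are generated by exchanges of adjacent blocks. Such an exchange is one instance of
    the relation, multiplied on the right by the remaining letters; [sdashv] forgets the center of
    its right factor, so any center on a block will do. *)
Lemma rcomm_ext d s t : perm_eq s t -> ext d s ≈ ext d t.
Proof.
move=> pst; apply: (catCA_perm_ind _ pst (P := fun t => ext d s ≈ ext d t));
  last exact: rcomm_refl.
move=> s1 s2 s3 /rcomm_trans; apply.
case: s1 s2 => [|x1 s1] [|x2 s2]; rewrite ?cats0; try exact: rcomm_refl.
set e1 := last_centered x1 s1; set e2 := last_centered x2 s2.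
have := rcomm_sdashv d e1 e2.
case: s3 => [|x3 s3].
  by congr (_ ≈ _); apply: diword_eq; rewrite // /dword /= -?catA ?cats0.
move/rcomm_sdashvr => /(_ (last_centered x3 s3)).
by congr (_ ≈ _); apply: diword_eq; rewrite // /dword /= -!catA.
Qed.

(** The same block exchange for [svdash], with every block centered at its last letter so that the
    products are too. *)
Lemma rcomm_last_centered y s t :
  perm_eq s t -> last_centered y s ≈ last_centered y t.
Proof.
move=> pst.
apply: (catCA_perm_ind _ pst (P := fun t => last_centered y s ≈ last_centered y t));
  last exact: rcomm_refl.
move=> s1 s2 s3 /rcomm_trans; apply.
case: s1 s2 => [|x1 s1] [|x2 s2]; rewrite ?cats0; try exact: rcomm_refl.
set e1 := last_centered x1 s1; set e2 := last_centered x2 s2.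
have := rcomm_svdash (last_centered y [::]) e1 e2.
case: s3 => [|x3 s3].
  by congr (_ ≈ _); apply: diword_eq; rewrite !diwordE /center /= ?cats0 ?size_cat //;
    size_lia.
move/rcomm_svdashr => /(_ (last_centered x3 s3)).
by congr (_ ≈ _); apply: diword_eq; rewrite !diwordE /center /= ?size_cat -?catA //;
  rewrite /= ?size_cat /=; size_lia.
Qed.

(* [y]_1 |- [a]_1 |- [v]_k is congruent to [y]_1 |- [v]_k |- [a]_1 = [y v a]_(|v|+2),
   which no longer depends on [k]. *)
Lemma rcomm_center y u d : dword d = y :: u -> 3 <= center d ->
  d ≈ last_centered y u.
Proof.
move=> du d3; have := center_le d; rewrite du /=.
case: u du => [|a [|b u]] du /=; try size_lia.
move=> ld; have q2 : is_normal ((b :: u : word X), (center d).-2).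
  by rewrite /is_normal /=; size_lia.
set e1 := last_centered y [::]; set e2 := last_centered a [::].
have := rcomm_svdash e1 e2 (last_centered b u).
have := rcomm_svdash e1 e2 (Diword q2).
have -> : svdash (svdash e1 e2) (Diword q2) = d.
  by apply: diword_eq; rewrite !diwordE ?du //= /center /= -/(center _); size_lia.
have -> : svdash (svdash e1 e2) (last_centered b u) = last_centered y [:: a, b & u].
  by apply: diword_eq; rewrite !diwordE.
have -> : svdash (svdash e1 (Diword q2)) e2 = svdash (svdash e1 (last_centered b u)) e2.
  by apply: diword_eq; rewrite !diwordE.
by move=> /rcomm_trans dx /rcomm_sym; apply: dx.
Qed.

Lemma rcomm_nf d : d ≈ nf d.
Proof.
have d0 := center_gt0 d; have ld := center_le d.
case wd : (dword d) ld => [|x u] /= ld; first by size_lia.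
have [d3|d3] := ltnP (center d) 3; last first.
  have pu : perm_eq u (sort <=%O u) by rewrite perm_sym perm_sort.
  have fd : frozen (center d) = 1 by apply: frozen_neq2; size_lia.
  apply: rcomm_trans (rcomm_center wd d3) _.
  apply: rcomm_trans (rcomm_last_centered x pu) (rcomm_sym _).
  apply: rcomm_center; last by rewrite /center /= -/(center d); size_lia.
  by rewrite /dword /= -/(dword d) -/(center d) /nf_word fd wd /= take0 drop0.
have nd : is_normal (take (frozen (center d)) (dword d) : word X, center d).
  rewrite /is_normal /= size_takel ?frozen_le // d0 /=.
  by case: (center d) d0 d3 => [|[|[|]]].
have ps : perm_eq (drop (frozen (center d)) (dword d))
                  (sort <=%O (drop (frozen (center d)) (dword d))).
  by rewrite perm_sym perm_sort.
have := rcomm_ext (Diword nd) ps; congr (_ ≈ _); apply: diword_eq => //.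
  by rewrite [LHS]/dword /= cat_take_drop.
by apply/esym/minn_idPl; exact: ltnW.
Qed.

Lemma congr_gen_nfP d e : d ≈ e <-> nf d = nf e.
Proof.
split=> [|nde]; first exact: congr_gen_nf.
apply: rcomm_trans (rcomm_nf d) _; rewrite nde; apply: rcomm_sym; exact: rcomm_nf.
Qed.

End NormalForm.

(** * The linear extension of the normal form and its kernel *)

Section Reduction.
Set Implicit Arguments.
Unset Strict Implicit.
Context {K : fieldType} {disp : Order.disp_t} {X : orderType disp}.
Local Notation Di := (Di K X).
Implicit Types (f g h s : Di) (d e : diword X).

Definition NF : Di -> Di := fglift (fun d => << nf d >>).

Lemma NFU c d : NF << c *g d >> = << c *g nf d >>.
Proof. by rewrite /NF liftU -freegUZ mulr1. Qed.

HB.instance Definition _ := GRing.isAdditive.Build Di Di NF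
  (lift_is_additive (fun d : diword X => << nf d >> : Di)).

Lemma NFD f g : NF (f + g) = NF f + NF g.
Proof. exact: raddfD. Qed.

Lemma NFB f g : NF (f - g) = NF f - NF g.
Proof. exact: raddfB. Qed.

Lemma NFE f : NF f = \sum_(d <- dom f) << coeff d f *g nf d >>.
Proof.
rewrite -{1}[f]freeg_sumE raddf_sum /=.
by apply: eq_bigr => d _; exact: NFU.
Qed.

Lemma NFZ c f : NF (c *: f) = c *: NF f.
Proof.
elim/Di_ind: f => [|a d f IH]; first by rewrite scaler0 raddf0 scaler0.
rewrite scalerDr NFD IH scalerA -[in LHS]freegUZ NFU NFD scalerDr; congr (_ + _).
by rewrite -freegUZ NFU -freegUZ !mulr1.
Qed.

Lemma NF_linear c f g : NF (c *: f + g) = c *: NF f + NF g.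
Proof. by rewrite NFD NFZ. Qed.

Definition nf_binomial d : Di := << d >> - << nf d >>.

Lemma NF_binomial d : NF (nf_binomial d) = 0.
Proof. by rewrite NFB !NFU nf_id subrr. Qed.

Lemma NF_sub f :
  f - NF f = \sum_(d <- dom f) coeff d f *: nf_binomial d.
Proof.
rewrite NFE -{1}[f]freeg_sumE -sumrB; apply: eq_bigr => d _.
by rewrite scalerBr -!freegUZ !mulr1.
Qed.

Lemma bilinear_ext (F G : Di -> Di -> Di) :
  (forall (c : K) f g h, F (c *: f + g) h = c *: F f h + F g h) ->
  (forall (c : K) f g h, F h (c *: f + g) = c *: F h f + F h g) ->
  (forall (c : K) f g h, G (c *: f + g) h = c *: G f h + G g h) ->
  (forall (c : K) f g h, G h (c *: f + g) = c *: G h f + G h g) ->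
  (forall d e, F << d >> << e >> = G << d >> << e >>) ->
  forall f g, F f g = G f g.
Proof.
move=> Fl Fr Gl Gr FG f g.
have lin0 (L : Di -> Di) :
    (forall (c : K) x y, L (c *: x + y) = c *: L x + L y) -> L 0 = 0.
  by move=> /(_ (-1) 0 0); rewrite !scaleN1r oppr0 addr0 addNr.
elim/Di_ind: f => [|c d f IH].
  by rewrite (lin0 (F^~ g)) ?(lin0 (G^~ g)).
rewrite Fl Gl IH; congr (_ *: _ + _); elim/Di_ind: g {IH} => [|b e g IH].
  by rewrite (lin0 (F _)) ?(lin0 (G _)).
by rewrite Fr Gr IH FG.
Qed.

(** Both sides are bilinear, so diwords suffice. This is what makes the kernel of [NF] absorb
    products. *)
Lemma NF_bilin (op : diword X -> diword X -> diword X) :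
  (forall d e d' e', nf d = nf d' -> nf e = nf e' -> nf (op d e) = nf (op d' e')) ->
  forall f g, NF (bilin op f g) = NF (bilin op (NF f) (NF g)).
Proof.
move=> nf_op; apply: bilinear_ext => [c f g h|c f g h|c f g h|c f g h|d e].
- by rewrite bilin_linearl NF_linear.
- by rewrite bilin_linearr NF_linear.
- by rewrite NF_linear bilin_linearl NF_linear.
- by rewrite NF_linear bilin_linearr NF_linear.
by rewrite !NFU !bilinUU !NFU (nf_op _ _ (nf d) (nf e)) ?nf_id.
Qed.

Lemma NF_vdash f g : NF (f ⊢ g)%di = NF (NF f ⊢ NF g)%di.
Proof.
apply: NF_bilin => d e d' e' /nf_eqP dd' /nf_eqP ee'.
by rewrite (proj2 (nf_eqP _ _) (nf_eq_svdashr _ dd')); apply/nf_eqP/nf_eq_svdashl.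
Qed.

Lemma NF_dashv f g : NF (f ⊣ g)%di = NF (NF f ⊣ NF g)%di.
Proof.
apply: NF_bilin => d e d' e' /nf_eqP dd' /nf_eqP ee'.
by rewrite (proj2 (nf_eqP _ _) (nf_eq_sdashvr _ dd')); apply/nf_eqP/nf_eq_sdashvl.
Qed.

Lemma bilin0l op g : bilin op 0 g = 0 :> Di.
Proof. by rewrite /bilin dom0 big_nil. Qed.

Lemma bilin0r op f : bilin op f 0 = 0 :> Di.
Proof. by rewrite /bilin big1 // => d _; rewrite dom0 big_nil. Qed.

Lemma ker_NF_ideal : is_ideal [set f | NF f = 0].
Proof.
split=> [|c f g /= f0 g0|f g /= f0]; first exact: raddf0.
  by rewrite NF_linear f0 g0 scaler0 addr0.
split=> /=.
- by rewrite NF_vdash f0 [X in NF X]bilin0l raddf0.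
- by rewrite NF_vdash f0 [X in NF X]bilin0r raddf0.
- by rewrite NF_dashv f0 [X in NF X]bilin0l raddf0.
- by rewrite NF_dashv f0 [X in NF X]bilin0r raddf0.
Qed.

Lemma ideal_sum (D : dialgebraType K) (I : set D) (T : Type) (r : seq T) (F : T -> D) :
  is_ideal I -> (forall i, I (F i)) -> I (\sum_(i <- r) F i).
Proof.
move=> [I0 Il _] IF; elim: r => [|i r IH]; first by rewrite big_nil.
by rewrite big_cons -[F i]scale1r; apply: Il.
Qed.

Lemma ideal_scale (D : dialgebraType K) (I : set D) (c : K) (x : D) :
  is_ideal I -> I x -> I (c *: x).
Proof. by move=> [I0 Il _] Ix; rewrite -[_ *: _]addr0; apply: Il. Qed.

Lemma ker_NF_sub (I : set Di) : is_ideal I ->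
  (forall d, I (nf_binomial d)) -> [set f | NF f = 0] `<=` I.
Proof.
move=> iI Inf f /= f0; rewrite -[f]subr0 -f0 NF_sub.
by apply: ideal_sum => // d; apply: ideal_scale.
Qed.

Lemma Id_Tprime_nf d : Id (Tprime K X) (nf_binomial d).
Proof.
(* [R] is a congruence containing the generating pairs, so it contains every congruent pair, in
   particular [d] with [nf d]. *)
pose R := [set p : diword X * diword X | Id (Tprime K X) (<< p.1 >> - << p.2 >>)].
have [I0 Il IM] := Id_ideal (Tprime K X).
suff : R (d, nf d) by [].
move/congr_genP: (rcomm_nf d); apply=> [|p Pp]; last first.
  by apply/IdP => I _; apply; exists p.
split=> [a|a b ab|a b c ab bc|a b c /= ab]; rewrite /R /=.
- by rewrite subrr.
- by rewrite -opprB -scaleN1r -[_ *: _]addr0; apply: Il.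
- by rewrite -(subrKA << b >>) -[X in X + _]scale1r; apply: Il.
have [] := IM _ << c >> ab.
by rewrite vdashBl vdashBr dashvBl dashvBr /vdash /dashv /= !bilinUU.
Qed.

Lemma Id_Tprime : Id (Tprime K X) = [set f | NF f = 0].
Proof.
rewrite eqEsubset; split; last first.
  by apply: ker_NF_sub; [exact: Id_ideal|exact: Id_Tprime_nf].
move=> f /IdP; apply; first exact: ker_NF_ideal.
move=> _ [p /nf_rcomm_pairs pp <-] /=.
by rewrite NFB !NFU pp subrr.
Qed.

(** * Leading diwords and the elements of [Sprime] *)

Lemma lead_ge f d : d \in dom f -> exists2 e, lead f = Some e & (d <= e)%O.
Proof.
rewrite /lead -(mem_sort >=%O).
have : sorted >=%O (sort >=%O (dom f)) by apply: sort_sorted => x y; exact: le_total.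
case: (sort _ _) => [//|e s] /= se; rewrite inE => de; exists e => //.
case/predU1P: de => [->//|ds].
have ge_trans : transitive (>=%O : rel (diword X)).
  by move=> y x z xy yz; apply: le_trans yz xy.
by have /allP/(_ _ ds) := order_path_min ge_trans se.
Qed.

Lemma lead_mem f d : lead f = Some d -> d \in dom f.
Proof.
rewrite /lead -(mem_sort >=%O); case: (sort _ _) => [|e s] //= [->].
exact: mem_head.
Qed.

Lemma nf_binomial_coeff d e :
  coeff e (nf_binomial d) = (d == e)%:R - (nf d == e)%:R.
Proof. by rewrite /nf_binomial coeffB !coeffU !mul1r. Qed.

Lemma nf_binomial_eq0 d : (nf_binomial d == 0) = (nf d == d).
Proof.
apply/eqP/eqP => [d0|nd]; last by rewrite /nf_binomial nd subrr.
have := congr1 (coeff d) d0; rewrite nf_binomial_coeff coeff0 eqxx.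
by case: eqP => // _ /eqP; rewrite subr0 oner_eq0.
Qed.

Lemma nf_binomial_lead d : nf d != d -> lead (nf_binomial d) = Some d.
Proof.
move=> nd; set f := nf_binomial d.
have df : d \in dom f.
  by rewrite mem_dom nf_binomial_coeff eqxx (negPf nd) subr0 oner_neq0.
have [e le de] := lead_ge df; rewrite le; congr Some; apply/le_anti.
rewrite de andbT; have := lead_mem le; rewrite mem_dom nf_binomial_coeff.
have [->//|_] := eqVneq d e; have [<-|_] := eqVneq (nf d) e; first by rewrite nf_le.
by rewrite subrr eqxx.
Qed.

Lemma dpoly_val d : dpoly K (dword d) (center d) = << d >>.
Proof.
rewrite /dpoly; have -> : (dword d, center d) = val d; last by rewrite valK.
by rewrite /dword /center; case: (val d).
Qed.

(** The center of [d] separates the two families: at most 2 for the first, at least 3 for the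
    second. *)
Lemma SprimeP f :
  Sprime K X f <-> exists2 d, nf d != d & f = nf_binomial d.
Proof.
split=> [[f0 Sf]|[d nd ->]].
  suff [d fd] : exists d, f = nf_binomial d.
    by exists d => //; rewrite -nf_binomial_eq0 -fd.
  case: Sf => [[u [v [x [u2 v1 ->]]]]|[u [v [x [y [v1 ->]]]]]].
    have nd : is_normal (v ++ x :: u : word X, (size v).+1).
      by rewrite /is_normal /= size_cat /= addnS ltnS leq_addr.
    exists (Diword nd); rewrite /nf_binomial -!dpoly_val; congr (_ - dpoly K _ _).
      by case: v v1 nd => [|y [|]] //= _ nd;
        rewrite /dword /= /nf_word /dword /center /= ?take0 drop0.
    by apply/esym/minn_idPl; exact: leqW.
  have nd : is_normal (y :: v ++ x :: u : word X, (size v).+2).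
    by rewrite /is_normal /= size_cat /= addnS !ltnS leq_addr.
  exists (Diword nd); rewrite /nf_binomial -!dpoly_val; congr (_ - dpoly K _ _).
    rewrite /dword /= /nf_word /dword /center /= frozen_neq2 ?take0 ?drop0 //;
    by case: v v1 nd.
  exact: esym (minn_idPr (v1 : (3 <= (size v).+2)%N)).
split; first by rewrite nf_binomial_eq0.
have {nd} : ~~ ((nf_word (center d) (dword d) == dword d) &&
                (minn (center d) 3 == center d)).
  by apply: contra nd => /andP[/eqP wd /eqP cd]; apply/eqP/diword_eq.
have wd : dword (nf d) = nf_word (center d) (dword d) by [].
have cd : center (nf d) = minn (center d) 3 by [].
have d0 := center_gt0 d; have ld := center_le d.
rewrite /nf_binomial -!dpoly_val wd cd {wd cd} /nf_word.
have [m3|m3] := leqP 3 (center d).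
  move=> _; right.
  move: (dword d) (center d) m3 ld {d0} => [|y p] [|[|[|m]]] //= _.
  rewrite ltnS => mp.
  (* The center is [m.+3], so the center letter is entry [m.+1] of [p], counted from 0; [v] and [u]
     are what precedes and follows it. *)
  exists (drop m.+2 p), (take m.+1 p).
  have [x xE] : exists x, drop m.+1 p = x :: drop m.+2 p.
    have x0 : X by case: p mp.
    by exists (nth x0 p m.+1); rewrite (drop_nth x0).
  have tp : take m.+1 p ++ x :: drop m.+2 p = p by rewrite -xE cat_take_drop.
  exists x, y; rewrite tp size_takel ?(ltnW mp) //; split=> //.
  by rewrite take0 drop0.
move=> nd; left.
move: (dword d) (center d) ld d0 m3 nd => [|x u] [|[|[|m]]] //= um _ _;
  rewrite eqxx andbT => nd.
  exists u, [::], x; rewrite take0 drop0 in nd *; split=> //.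
  (* A tail of at most one letter is already sorted, so [nd] forces two letters in [u]. *)
  by case: u {um} nd => [|a [|b u]] //=; rewrite eqxx.
case: u um nd => [|y u] //= _; rewrite take0 drop0 => nd.
by exists u, [:: x], y; split=> //; case: u nd => [|a [|b u]] //=; rewrite eqxx.
Qed.

Lemma Id_Sprime : Id (Sprime K X) = [set f | NF f = 0].
Proof.
have [I0 _ _] := Id_ideal (Sprime K X).
rewrite eqEsubset; split=> [f /IdP|].
  apply; first exact: ker_NF_ideal.
  by move=> _ /SprimeP[d _ ->]; exact: NF_binomial.
apply: ker_NF_sub => [|d]; first exact: Id_ideal.
have [/eqP|nd] := eqVneq (nf d) d; first by rewrite -nf_binomial_eq0 => /eqP->.
by apply/IdP => I _; apply; apply/SprimeP; exists d.
Qed.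

(** * Triviality of the compositions *)

Lemma sdiword_center s : sdiword [::] s [::] (pcenter s) = s.
Proof. by rewrite /sdiword /=; case: (pcenter s) => //= n; rewrite eqxx. Qed.

Lemma Pset_center s : Pset [::] s [::] (pcenter s).
Proof. by rewrite /Pset add0n eqxx orbT. Qed.

Lemma trivial_mod_ker_NF h : NF h = 0 -> trivial_mod (Sprime K X) h.
Proof.
(* Diwords fixed by [nf] give the zero binomial, which is not in [Sprime], so they are dropped from
   the sum. *)
move=> h0; pose r := [seq d <- dom h | nf d != d].
have hE : h = \sum_(d <- r) coeff d h *: nf_binomial d.
  rewrite big_filter -[LHS]subr0 -[X in _ - X]h0 NF_sub (bigID (fun d => nf d != d)) /=.
  rewrite [X in _ + X]big1 ?addr0 // => d /negPn.
  by rewrite -nf_binomial_eq0 => /eqP->; rewrite scaler0.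
pose b i := nf_binomial (tnth (in_tuple r) i).
exists (size r), (fun i => coeff (tnth (in_tuple r) i) h), (fun=> [::]), (fun=> [::]), b,
  (fun i => pcenter (b i)); split=> [i|]; last first.
  rewrite {1}hE big_tnth; apply: eq_bigr => i _.
  by rewrite sdiword_center.
have := mem_tnth i (in_tuple r); rewrite mem_filter => /andP[ni hi].
split; [by apply/SprimeP; exists (tnth (in_tuple r) i)|exact: Pset_center|].
by rewrite sdiword_center nf_binomial_lead //=; have [e -> de] := lead_ge hi.
Qed.

Lemma sdiword_ideal (I : set Di) (a c : word X) s m :
  is_ideal I -> I s -> I (sdiword a s c m).
Proof.
move=> [_ _ IM].
have Ilv u l f : I f -> I (lvdash u l f).
  by case: u => // y u /(IM _ (dpoly K (y :: u) l))[].
have Ild u l f : I f -> I (ldashv u l f).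
  by case: u => // y u /(IM _ (dpoly K (y :: u) l))[].
have Irv u l f : I f -> I (rvdash f u l).
  by case: u => // y u /(IM _ (dpoly K (y :: u) l))[].
have Ird u l f : I f -> I (rdashv f u l).
  by case: u => // y u /(IM _ (dpoly K (y :: u) l))[].
move=> Is; rewrite /sdiword; case: ifP => _; first exact/Ird/Ild.
by case: ifP => _; [exact/Ird/Ilv|exact/Irv/Ilv].
Qed.

Lemma composition_ideal (I : set Di) f g h :
  is_ideal I -> I f -> I g -> composition f g h -> I h.
Proof.
move=> iI If Ig; have [_ Il IM] := iI.
have IB p q : I p -> I q -> I (p - q).
  by move=> Ip Iq; rewrite addrC -scaleN1r; apply: Il.
case=> [x _|u _ _|*|*|*|*|*|*]; try by apply: IB => //; apply: sdiword_ideal.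
- by have [] := IM f (dpoly K [:: x] 1) If.
- by have [] := IM f (dpoly K u (size u)) If.
Qed.

(** No composition is computed: each lies in the ideal generated by its two arguments, hence in the
    kernel of [NF]. *)
Lemma Sprime_GSbasis : is_GSbasis (Sprime K X).
Proof.
split=> [_ /SprimeP[d nd ->]|f g h Sf Sg].
  rewrite /Defs.monic /lc nf_binomial_lead // nf_binomial_coeff eqxx.
  by rewrite (negPf nd) subr0 eqxx.
move/(composition_ideal (Id_ideal (Sprime K X))) => Ih.
apply: trivial_mod_ker_NF.
have: Id (Sprime K X) h by apply: Ih; apply/IdP => I _; apply.
by rewrite Id_Sprime.
Qed.

(** * Normal forms in the two quotients *)

Local Notation Q := (dquot (Tprime K X)).

Lemma pi_dquot_eq f g : (\pi_Q f = \pi_Q g) <-> NF f = NF g.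
Proof.
split=> [/eqP/dquotP|fg]; last apply/eqP/dquotP.
  by rewrite Id_Tprime /= NFB => /eqP; rewrite subr_eq0 => /eqP.
by rewrite Id_Tprime /= NFB fg subrr.
Qed.

Lemma pi_dquot_sum (r : seq (diword X)) (c : diword X -> K) :
  \sum_(d <- r) c d *: \pi_Q (<< d >> : Di) = \pi_Q (\sum_(d <- r) << c d *g d >>).
Proof.
rewrite raddf_sum; apply: eq_bigr => d _.
by rewrite -[c d in RHS]mulr1 freegUZ; apply/esym/pi_qscale.
Qed.

Lemma NF_normal f : (forall d, d \in dom f -> nf d = d) -> NF f = f.
Proof.
move=> nf_f; rewrite NFE -[RHS]freeg_sumE.
by apply: eq_big_seq => d /nf_f->.
Qed.

Lemma rcomm_normal_basis :
  is_basis (rcomm_normal X) (fun d : diword X => \pi_Q (<< d >> : Di)).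
Proof.
split=> [d e /rcomm_normalP nd /rcomm_normalP ne /pi_dquot_eq|r c ur nr|v].
- rewrite !NFU nd ne => /(congr1 (coeff e)); rewrite !coeffU !mul1r eqxx.
  by case: eqP => // _ /eqP; rewrite eq_sym oner_eq0.
(* The combination vanishes in the quotient, so [NF] kills it; as [NF] fixes each of its diwords,
   the coefficient of [d] can be read off. *)
- rewrite pi_dquot_sum => c0 d dr.
  have {}c0 : NF (\sum_(d <- r) << c d *g d >>) = 0.
    by rewrite -[RHS](raddf0 NF); apply/pi_dquot_eq; rewrite c0 raddf0.
  have := congr1 (coeff d) c0; rewrite coeff0 raddf_sum raddf_sum /=.
  rewrite (bigD1_seq d) //= NFU (proj1 (rcomm_normalP d) (nr d dr)) coeffU eqxx mulr1.
  rewrite big_seq_cond big1 ?addr0 // => e /andP[er ed].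
  by rewrite NFU (proj1 (rcomm_normalP e) (nr e er)) coeffU (negPf ed) mulr0.
have dNF f d : d \in dom (NF f) -> nf d = d.
  rewrite NFE => /dom_sum_subset/flatten_mapP[e _].
  have [->|c0] := eqVneq (coeff e f) 0; first by rewrite freegU0 dom0.
  by rewrite domU // inE => /eqP->; rewrite nf_id.
(* A representative is replaced by its normal form, whose support consists of fixed points of
   [nf]. *)
exists (dom (NF (repr v))), (fun d => coeff d (NF (repr v))).
split=> [d /dNF /rcomm_normalP //|].
rewrite pi_dquot_sum freeg_sumE -[LHS]reprK; apply/pi_dquot_eq.
by rewrite [RHS]NF_normal //; apply: dNF.
Qed.

End Reduction.

(** The congruence is the kernel of the idempotent [nf], so each class contains exactly one fixed
    point. *)
Lemma disgp_quot_normal_form (disp : Order.disp_t) (X : orderType disp)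
    (c : disgp_quot (rcomm_pairs X)) :
  exists! d : diword X, rcomm_normal X d /\ \pi_(disgp_quot (rcomm_pairs X)) d = c.
Proof.
exists (nf (repr c)); split.
  split; first exact: nf_normal.
  rewrite -[RHS]reprK; apply/eqmodP/congr_relP/congr_gen_nfP; exact: nf_id.
move=> d [/rcomm_normalP nd dc]; rewrite -nd.
by apply/congr_gen_nfP/congr_relP/eqmodP; rewrite reprK dc.
Qed.

Theorem proposition5p13 (K : fieldType) (disp : Order.disp_t)
    (X : orderType disp) (X_wo : well_order (<=%O : rel X)) :
  [/\ Id (Tprime K X) = Id (Sprime K X),
      is_GSbasis (Sprime K X),
      is_basis (rcomm_normal X)
        (fun d : diword X => \pi_(dquot (Tprime K X)) (<< d >> : Di K X)) &
      forall c : disgp_quot (rcomm_pairs X),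
        exists! d : diword X,
          rcomm_normal X d /\ \pi_(disgp_quot (rcomm_pairs X)) d = c].
Proof.
split; first by rewrite Id_Tprime Id_Sprime.
- exact: Sprime_GSbasis.
- exact: rcomm_normal_basis.
- exact: disgp_quot_normal_form.
Qed.
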